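(* Let $(\Omega,\mathcal{F}_2,\mathbb{P})$ be a probability space and let $\mathcal{F}_1\subset\mathcal{F}_2$ be a sub sigma algebra. Then $\mathcal{F}_2$ is atomless conditionally to $\mathcal{F}_1$ if and only if there exists an atomless sigma algebra $\mathcal{B}\subset\mathcal{F}_2$ that is independent of $\mathcal{F}_1$.
   Context: Definition. $\mathcal{F}_2$ is atomless conditionally to $\mathcal{F}_1$ if for every $A\in\mathcal{F}_2$ there exists a set $B\subset A$, $B\in\mathcal{F}_2$, such that $0<\mathbb{E}[\mathbf{1}_B\mid\mathcal{F}_1]<\mathbb{E}[\mathbf{1}_A\mid\mathcal{F}_1]$ (almost surely) on the set $\{\mathbb{E}[\mathbf{1}_A\mid\mathcal{F}_1]>0\}$. A sub sigma algebra $\mathcal{B}\subset\mathcal{F}_2$ is atomless if the restriction of $\mathbb{P}$ to $\mathcal{B}$ has no atoms, i.e. for every $A\in\mathcal{B}$ with $\mathbb{P}[A]>0$ there is $B\in\mathcal{B}$, $B\subset A$, with $0<\mathbb{P}[B]<\mathbb{P}[A]$. *)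

(* Defs.v *)
From HB Require Import structures.
From mathcomp Require Import all_boot all_order all_algebra.
From mathcomp Require Import all_classical all_reals all_analysis measurable_realfun.

Set Implicit Arguments.
Unset Strict Implicit.
Unset Printing Implicit Defensive.

Import Order.TTheory GRing.Theory Num.Theory.
Import numFieldNormedType.Exports.

Local Open Scope classical_set_scope.
Local Open Scope ring_scope.
Local Open Scope ereal_scope.

Definition is_sub_sigma_algebra (d : measure_display) (T : measurableType d)
    (F : set (set T)) : Prop :=
  sigma_algebra setT F /\ F `<=` measurable.

(* [g] is a version of E[X | F]; the first clause is measurability of [g] with
   respect to [F], since <<s F >> = F when [F] is a sigma-algebra. *)
Definition is_cond_expectation (d : measure_display) (T : measurableType d)
    (R : realType) (P : probability T R) (F : set (set T)) (X g : T -> R) :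
    Prop :=
  [/\ measurable_fun [set: g_sigma_algebraType F]
        (g : g_sigma_algebraType F -> R),
      P.-integrable [set: T] (EFin \o g) &
      forall C, F C -> \int[P]_(x in C) (g x)%:E = \int[P]_(x in C) (X x)%:E].

(* A chosen version of E[X | F]; the default value 0 is never reached when [X]
   is integrable, see [cond_expectationP]. *)
Definition cond_expectation (d : measure_display) (T : measurableType d)
    (R : realType) (P : probability T R) (F : set (set T)) (X : T -> R) :
    T -> R :=
  xget (cst 0%R) [set g | is_cond_expectation P F X g].

Section cond_expectation_versions.
Context (d : measure_display) (T : measurableType d) (R : realType).
Variables (P : probability T R) (F : set (set T)).
Hypothesis sF : is_sub_sigma_algebra F.

Local Notation TF := (g_sigma_algebraType F).

Let measurable_TF (C : set T) : (measurable : set (set TF)) C = F C.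
Proof. by rewrite (measurable_g_measurableTypeE sF.1). Qed.

Let toF : T -> TF := idfun.

Let measurable_toF : measurable_fun [set: T] toF.
Proof.
by move=> _ Y; rewrite measurable_TF setTI preimage_id; exact: sF.2.
Qed.

HB.instance Definition _ := isMeasurableFun.Build _ _ _ _ toF measurable_toF.

Let PF : probability TF R := distribution P toF.

Let measurable_funTF (f : T -> \bar R) :
  measurable_fun [set: TF] (f : TF -> _) -> measurable_fun [set: T] f.
Proof. by move=> mf; exact: (measurableT_comp mf measurable_toF). Qed.

Let integral_PF (f : TF -> \bar R) (C : set T) : F C ->
  measurable_fun [set: TF] f -> P.-integrable setT (f : T -> \bar R) ->
  \int[PF]_(x in C) f x = \int[P]_(x in C) f x.
Proof.
move=> FC mf intf; rewrite integral_pushforward ?measurable_TF//.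
apply: integrableS intf => //.
exact: sF.2.
Qed.

Lemma cond_expectation_exists (X : T -> R) :
  P.-integrable setT (EFin \o X) -> exists g, is_cond_expectation P F X g.
Proof.
move=> intX.
pose nu : set TF -> \bar R := fun C => induced_charge intX (C : set T).
have nu0 : nu set0 = 0 by exact: charge0.
have nufin C : measurable C -> nu C \is a fin_num.
  by rewrite measurable_TF => FC; apply: fin_num_measure; exact: sF.2.
have nus : semi_sigma_additive nu.
  move=> G mG tG mUG.
  apply: (charge_semi_sigma_additive (s := induced_charge intX)) => //.
    by move=> n; apply: sF.2; rewrite -measurable_TF.
  by apply: sF.2; rewrite -measurable_TF.
pose nuM := isCharge.Build _ _ _ nu nu0 nufin nus.
pose nuC : {charge set TF -> \bar R} := HB.pack nu nuM.
have nuPF : nuC `<< PF.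
  apply/null_content_dominatesP => C; rewrite measurable_TF => FC PC0.
  apply: null_set_integral => //; first exact: sF.2.
  by apply: measurable_funTS; exact: (measurable_int _ intX).
have [f [ffin intf nuf]] : exists f : TF -> \bar R,
    [/\ (forall x, f x \is a fin_num), PF.-integrable [set: TF] f &
    forall A, measurable A -> nu A = \int[PF]_(x in A) f x].
  exists (Radon_Nikodym nuC PF); split.
  - by move=> x; exact: Radon_Nikodym_fin_num.
  - exact: Radon_Nikodym_integrable.
  - by move=> A mA; exact: (Radon_Nikodym_integral nuPF mA).
have fE : f = EFin \o (fine \o f) by apply/funext => x /=; rewrite fineK.
have mf : measurable_fun [set: TF] f := measurable_int _ intf.
have intfP : P.-integrable [set: T] (f : T -> \bar R).
  apply/integrableP; split; first exact: measurable_funTF.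
  move/integrableP : intf => [_].
  rewrite ge0_integral_pushforward//.
  exact: measurableT_comp.
exists (fine \o f); split.
- exact: measurableT_comp.
- by rewrite -fE.
- move=> C FC; transitivity (\int[P]_(x in C) f x).
    by apply: eq_integral => x _; rewrite /= fineK.
  by rewrite -integral_PF// -nuf ?measurable_TF.
Qed.

Lemma cond_expectationP (X : T -> R) : P.-integrable setT (EFin \o X) ->
  is_cond_expectation P F X (cond_expectation P F X).
Proof.
by move=> /cond_expectation_exists[g gX]; exact: (xgetPex _ (ex_intro _ g gX)).
Qed.

Lemma cond_expectation_ae_unique (X g h : T -> R) :
  is_cond_expectation P F X g -> is_cond_expectation P F X h ->
  {ae P, forall x, g x = h x}.
Proof.
move=> [mg ig gX] [mh ih hX].
have mgE : measurable_fun [set: TF] (EFin \o g : TF -> \bar R).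
  by apply/measurable_EFinP.
have mhE : measurable_fun [set: TF] (EFin \o h : TF -> \bar R).
  by apply/measurable_EFinP.
have [N [mN PN0 subN]] :
    ae_eq PF setT (EFin \o g : TF -> \bar R) (EFin \o h : TF -> \bar R).
  apply: integral_ae_eq => //.
    by apply: integrable_pushforward.
  move=> E _; rewrite measurable_TF => FE.
  by rewrite !integral_PF//= gX// hX.
exists N; split => //; first by apply: sF.2; rewrite -measurable_TF.
apply: subset_trans subN => x /= ghx; apply: contra_not ghx => /(_ I).
by case.
Qed.

End cond_expectation_versions.

(* By [cond_expectation_ae_unique] this does not depend on the chosen versions
   of the conditional expectations. *)
Definition conditionally_atomless (d : measure_display) (T : measurableType d)
    (R : realType) (P : probability T R) (F : set (set T)) : Prop :=
  forall A : set T, measurable A ->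
  exists B : set T, [/\ measurable B, B `<=` A &
    {ae P, forall x,
      (0 < cond_expectation P F \1_A x)%R ->
      (0 < cond_expectation P F \1_B x < cond_expectation P F \1_A x)%R}].

Definition atomless_on (d : measure_display) (T : measurableType d)
    (R : realType) (P : probability T R) (G : set (set T)) : Prop :=
  forall A : set T, G A -> 0 < P A ->
  exists B : set T, [/\ G B, B `<=` A & 0 < P B < P A].

Definition independent_set_systems (d : measure_display)
    (T : measurableType d) (R : realType) (P : probability T R)
    (G F : set (set T)) : Prop :=
  forall A B : set T, G A -> F B -> P (A `&` B) = P A * P B.

(* Main.v *)
(* Both conditions amount to the existence of a binary tree of sets [D s], [s] a
   finite word of bits, in which each set is the disjoint union of its two
   children and P(D s & C) = 2^-|s| P(C) for all C in F1.

   Such a tree comes from conditional halving: if every A contains some B with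
   0 < E[1_B|F1] < E[1_A|F1] on {E[1_A|F1] > 0}, then every A contains some B
   with E[1_B|F1] = E[1_A|F1] / 2.  Indeed, choosing between B and A \ B on an
   F1-set and iterating gives subsets with small positive conditional
   probability; these enlarge any M with E[1_M|F1] <= E[1_A|F1] / 2 that falls
   short of equality, so an M of maximal probability is a half.

   The sigma-algebra generated by a tree is atomless and independent of F1.
   Conversely, an atomless sigma-algebra independent of F1 contains a tree, by
   halving relative to the trivial sigma-algebra.  For any A, at almost every
   point where f = E[1_A|F1] > 0, some [s] has 0 < E[1_(A & D s)|F1] < f,
   since otherwise some [s] at every level n would give f <= 2^-n; glueing the
   sets A & D s along the F1-sets where [s] is the first such word splits A. *)
Require Import Defs.
From HB Require Import structures.
From mathcomp Require Import all_boot all_order all_algebra.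
From mathcomp Require Import all_classical all_reals all_analysis measurable_realfun.
From mathcomp Require Import lra.

Set Implicit Arguments.
Unset Strict Implicit.
Unset Printing Implicit Defensive.

Import Order.TTheory GRing.Theory Num.Theory.
Import numFieldNormedType.Exports.

Local Open Scope classical_set_scope.
Local Open Scope ring_scope.

(** * Closure properties of sub sigma-algebras *)

Section sub_sigma_algebra.
Context (d : measure_display) (T : measurableType d) (F : set (set T)).
Hypothesis sF : is_sub_sigma_algebra F.

Lemma sub_sigma_algebra_measurableE :
  (measurable : set (set (g_sigma_algebraType F))) = F.
Proof. exact: measurable_g_measurableTypeE sF.1. Qed.

Lemma subset_measurable (C : set T) : F C -> measurable C.
Proof. exact: sF.2. Qed.

Lemma sub_sigma_algebraI (A B : set T) : F A -> F B -> F (A `&` B).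
Proof. by rewrite -sub_sigma_algebra_measurableE; exact: measurableI. Qed.

Lemma sub_sigma_algebraU (A B : set T) : F A -> F B -> F (A `|` B).
Proof. by rewrite -sub_sigma_algebra_measurableE; exact: measurableU. Qed.

Lemma sub_sigma_algebraD (A B : set T) : F A -> F B -> F (A `\` B).
Proof. by rewrite -sub_sigma_algebra_measurableE; exact: measurableD. Qed.

Lemma sub_sigma_algebraT : F setT.
Proof. by rewrite -sub_sigma_algebra_measurableE; exact: measurableT. Qed.

End sub_sigma_algebra.

(** * Probabilities as real numbers *)

Section real_probability.
Context (d : measure_display) (T : measurableType d) (R : realType).
Variable P : probability T R.
Local Notation p A := (fine (P A)).

Lemma fine_probK (A : set T) : measurable A -> (p A)%:E = P A.
Proof. by move=> mA; rewrite fineK ?fin_num_measure. Qed.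

Lemma fine_prob_ge0 (A : set T) : 0 <= p A.
Proof. exact: fine_ge0. Qed.

Lemma fine_probT : p setT = 1.
Proof. by rewrite probability_setT. Qed.

Lemma fine_prob_gt0 (A : set T) : measurable A -> (0 < p A) = (0 < P A)%E.
Proof. by move=> mA; rewrite -lte_fin fine_probK. Qed.

Lemma fine_prob_le (A B : set T) : measurable A -> measurable B ->
  A `<=` B -> p A <= p B.
Proof.
by move=> mA mB AB; rewrite -lee_fin !fine_probK// le_measure ?inE.
Qed.

Lemma fine_probDI (A B : set T) : measurable A -> measurable B ->
  p A = p (A `\` B) + p (A `&` B).
Proof.
move=> mA mB; rewrite {1}(measureDI P mA mB) fineD// fin_num_measure//.
  exact: measurableD.
exact: measurableI.
Qed.

Lemma fine_probU (A B : set T) : measurable A -> measurable B ->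
  A `&` B = set0 -> p (A `|` B) = p A + p B.
Proof.
move=> mA mB AB0.
by rewrite measureU// fineD// fin_num_measure.
Qed.

End real_probability.

(** * Conditional probabilities, compared through integrals over sets of [F] *)

Section conditional_expectation.
Context (d : measure_display) (T : measurableType d) (R : realType).
Variables (P : probability T R) (F : set (set T)).
Hypothesis sF : is_sub_sigma_algebra F.

Local Notation TF := (g_sigma_algebraType F).
Local Notation p A := (fine (P A)).
Local Notation ce A := (cond_expectation P F \1_A).

Definition sub_integrable (u : T -> R) :=
  measurable_fun [set: TF] (u : TF -> R) /\ P.-integrable setT (EFin \o u).

Lemma sub_integrableS (u : T -> R) (C : set T) :
  sub_integrable u -> F C -> P.-integrable C (EFin \o u).
Proof.
move=> [_ iu] FC; apply: integrableS iu => //.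
exact: (subset_measurable sF).
Qed.

Lemma sub_integrableB (u v : T -> R) : sub_integrable u -> sub_integrable v ->
  sub_integrable (fun x => u x - v x).
Proof.
move=> [mu iu] [mv iv]; split; first exact: measurable_funB.
by have := integrableB measurableT iu iv; apply: eq_integrable.
Qed.

Lemma sub_integrableD (u v : T -> R) : sub_integrable u -> sub_integrable v ->
  sub_integrable (fun x => u x + v x).
Proof.
move=> [mu iu] [mv iv]; split; first exact: measurable_funD.
by have := integrableD measurableT iu iv; apply: eq_integrable.
Qed.

Lemma sub_integrableZ (a : R) (u : T -> R) : sub_integrable u ->
  sub_integrable (fun x => a * u x).
Proof.
move=> [mu iu]; split; first exact: measurable_funM.
by have := integrableZl measurableT a iu; apply: eq_integrable.
Qed.

Lemma sub_integrable_cst (a : R) : sub_integrable (fun=> a).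
Proof.
split; first exact: measurable_cst.
exact: finite_measure_integrable_cst.
Qed.

Lemma sub_integrable_le (u v : T -> R) : sub_integrable u ->
  sub_integrable v -> F [set x | u x <= v x].
Proof.
move=> [mu _] [mv _]; rewrite -(sub_sigma_algebra_measurableE sF).
by rewrite -[X in measurable X]setTI; exact: measurable_fun_le.
Qed.

Lemma sub_integrable_lt (u v : T -> R) : sub_integrable u ->
  sub_integrable v -> F [set x | u x < v x].
Proof.
move=> iu iv; rewrite (_ : mkset _ = setT `\` [set x | v x <= u x]).
  by apply: (sub_sigma_algebraD sF);
    [exact: (sub_sigma_algebraT sF)|exact: sub_integrable_le].
apply/seteqP; split => x /=; last first.
  by move=> [_ /negP]; rewrite -ltNge.
by move=> h; split => //; apply/negP; rewrite -ltNge.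
Qed.

(** On [C] the function equals its absolute value, so a nonpositive integral makes it vanish a.e.
    there, against [0 < u] unless [C] is null. *)
Lemma null_of_Rintegral_le0 (u : T -> R) (C : set T) : sub_integrable u ->
  F C -> (forall x, C x -> 0 < u x) -> \int[P]_(x in C) u x <= 0 -> P C = 0%E.
Proof.
move=> iu FC u0 intu.
have mC := subset_measurable sF FC.
have iuC := sub_integrableS iu FC.
have : ae_eq P C (EFin \o u) (cst 0%E).
  apply/ae_eq_integral_abs => //; first exact: measurable_int iuC.
  transitivity (\int[P]_(x in C) u x)%:E.
    rewrite fineK; last exact: integrable_fin_num.
    by apply: eq_integral => x /set_mem Cx /=; rewrite ger0_norm// ltW// u0.
  apply/congr1/eqP; rewrite eq_le intu fine_ge0//.
  by apply: integral_ge0 => x Cx; rewrite lee_fin ltW// u0.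
move=> [N [mN N0 CN]]; apply: subset_measure0 N0 => // x Cx; apply: CN => /= h.
by have := u0 x Cx; have [->] := h Cx; rewrite ltxx.
Qed.

(** The exceptional set, where [v < u] inside [G], itself lies in [F]; the hypothesis applied to it
    makes it null. *)
Lemma ae_le_of_Rintegral_le (u v : T -> R) (G : set T) : sub_integrable u ->
  sub_integrable v -> F G ->
  (forall C, F C -> C `<=` G ->
    \int[P]_(x in C) u x <= \int[P]_(x in C) v x) ->
  {ae P, forall x, G x -> u x <= v x}.
Proof.
move=> iu iv FG uv; have Flt := sub_integrable_lt iv iu.
have FC := sub_sigma_algebraI sF FG Flt.
exists (G `&` [set x | v x < u x]); split.
- exact: (subset_measurable sF).
- apply: (null_of_Rintegral_le0 (sub_integrableB iu iv)) => //.
    by move=> x [_ /=]; rewrite subr_gt0.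
  rewrite RintegralB ?subr_le0 ?uv//; first exact: (subset_measurable sF).
  - exact: sub_integrableS.
  - exact: sub_integrableS.
- by move=> x /= /not_implyP[Gx /negP]; rewrite -ltNge.
Qed.

Section indicators.
Implicit Types (A B C G : set T).

Let ceP A : measurable A ->
  is_cond_expectation P F \1_A (ce A).
Proof. by move=> mA; apply: cond_expectationP => //; exact: integrable_indic. Qed.

Lemma ce_sub_integrable A : measurable A -> sub_integrable (ce A).
Proof. by move=> /ceP[]. Qed.

Lemma Rintegral_ce A C : measurable A -> F C ->
  \int[P]_(x in C) ce A x = p (A `&` C).
Proof.
move=> mA FC; have [_ _ /(_ _ FC)] := ceP mA.
rewrite /Rintegral => ->; rewrite integral_indic//.
exact: (subset_measurable sF).
Qed.

(** Monotonicity localised to an [F]-set; used in both directions, it identifies the conditional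
    probabilities of sets that coincide on [G]. *)
Lemma ae_ce_le A B G : measurable A -> measurable B -> F G ->
  A `&` G `<=` B -> {ae P, forall x, G x -> ce A x <= ce B x}.
Proof.
move=> mA mB FG AB.
apply: (ae_le_of_Rintegral_le (ce_sub_integrable mA) (ce_sub_integrable mB) FG).
move=> C FC CG; rewrite !Rintegral_ce//.
have mC := subset_measurable sF FC.
apply: fine_prob_le; [exact: measurableI|exact: measurableI|].
by move=> x [Ax Cx]; split => //; apply: AB; split => //; exact: CG.
Qed.

Lemma ae_ce_ge0 A : measurable A -> {ae P, forall x, 0 <= ce A x}.
Proof.
move=> mA.
have : {ae P, forall x, setT x -> 0 <= ce A x}.
  apply: ae_le_of_Rintegral_le (sub_integrable_cst 0) _ _ _.
  - exact: ce_sub_integrable.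
  - exact: sub_sigma_algebraT.
  - move=> C FC _; rewrite Rintegral_ce// Rintegral_cst//; last first.
      exact: (subset_measurable sF).
    by rewrite mul0r fine_prob_ge0.
by apply: filterS => x; apply.
Qed.

Lemma ae_ce_le_cst A (a : R) : measurable A ->
  (forall C, F C -> p (A `&` C) <= a * p C) -> {ae P, forall x, ce A x <= a}.
Proof.
move=> mA Aa.
have : {ae P, forall x, setT x -> ce A x <= a}.
  apply: ae_le_of_Rintegral_le (ce_sub_integrable _) (sub_integrable_cst a) _ _ => //.
  - exact: sub_sigma_algebraT.
  - move=> C FC _; rewrite Rintegral_ce// Rintegral_cst ?Aa//.
    exact: (subset_measurable sF).
by apply: filterS => x; apply.
Qed.

Lemma ae_ceU A B : measurable A -> measurable B -> A `&` B = set0 ->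
  {ae P, forall x, ce (A `|` B) x = ce A x + ce B x}.
Proof.
move=> mA mB AB0; have mAB := measurableU _ _ mA mB.
have [iA iB iAB] := And3 (ce_sub_integrable mA) (ce_sub_integrable mB)
  (ce_sub_integrable mAB).
have intE C : F C -> \int[P]_(x in C) ce (A `|` B) x =
    \int[P]_(x in C) (ce A x + ce B x).
  move=> FC; have mC := subset_measurable sF FC.
  rewrite RintegralD//; try exact: sub_integrableS.
  rewrite !Rintegral_ce// setIUl fine_probU//; try exact: measurableI.
  by rewrite setIACA AB0 set0I.
have le1 : {ae P, forall x, setT x -> ce (A `|` B) x <= ce A x + ce B x}.
  apply: ae_le_of_Rintegral_le => //; first exact: sub_integrableD.
    exact: sub_sigma_algebraT.
  by move=> C FC _; rewrite intE.
have le2 : {ae P, forall x, setT x -> ce A x + ce B x <= ce (A `|` B) x}.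
  apply: ae_le_of_Rintegral_le => //; first exact: sub_integrableD.
    exact: sub_sigma_algebraT.
  by move=> C FC _; rewrite intE.
by apply: filterS2 le1 le2 => x h1 h2; apply/eqP; rewrite eq_le h1// h2.
Qed.

(** If [B] is null over [C], then [ce B > 0] almost nowhere on [C], hence likewise [ce A > 0], and
    integrating [ce A] over [C] gives at most 0. This turns a.s. positivity into positivity on
    [F]-sets. *)
Lemma measure_gt0_of_ce A B C : measurable A -> measurable B -> F C ->
  {ae P, forall x, 0 < ce A x -> 0 < ce B x} ->
  0 < p (A `&` C) -> 0 < p (B `&` C).
Proof.
move=> mA mB FC AB; apply: contraLR; rewrite -!leNgt => B0.
have [iA iB] := (ce_sub_integrable mA, ce_sub_integrable mB).
pose C0 := C `&` [set x | 0 < ce B x].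
have FC0 : F C0.
  apply: (sub_sigma_algebraI sF) => //.
  exact: sub_integrable_lt (sub_integrable_cst 0) _.
have C00 : P C0 = 0%E.
  apply: (null_of_Rintegral_le0 iB) => //; first by move=> x [].
  rewrite Rintegral_ce//; apply: le_trans B0.
  have [mC mC0] := (subset_measurable sF FC, subset_measurable sF FC0).
  by apply: fine_prob_le; [exact: measurableI|exact: measurableI|move=> x [? []]].
pose C1 := C `&` [set x | 0 < ce A x].
have FC1 : F C1.
  apply: (sub_sigma_algebraI sF) => //.
  exact: sub_integrable_lt (sub_integrable_cst 0) _.
have C10 : P C1 = 0%E.
  move: AB => [N [mN N0 ABN]].
  apply: (@subset_measure0 _ _ _ P _ (C0 `|` N)).
  - exact: (subset_measurable sF).
  - by apply: measurableU => //; exact: (subset_measurable sF).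
  - move=> x [Cx A0]; have [Bx|Bx] := boolP (0 < ce B x); first by left.
    by right; apply: ABN => /= /(_ A0); exact/negP.
  - by apply: null_set_setU => //; exact: (subset_measurable sF).
have [mC mC1] := (subset_measurable sF FC, subset_measurable sF FC1).
rewrite (@fine_probDI _ _ _ P (A `&` C) C1)//; last exact: measurableI.
have -> : p (A `&` C `&` C1) = 0.
  suff -> : P (A `&` C `&` C1) = 0%E by [].
  have mACC1 : measurable (A `&` C `&` C1).
    by apply: measurableI => //; exact: measurableI.
  by apply: subset_measure0 C10 => // x [].
rewrite addr0 -setIDA -Rintegral_ce//; last exact: (sub_sigma_algebraD sF).
have FD : F (C `\` C1) by exact: (sub_sigma_algebraD sF).
rewrite -(mul0r (p (C `\` C1))) -Rintegral_cst; last exact: (subset_measurable sF).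
apply: le_Rintegral; first exact: (subset_measurable sF).
- exact: sub_integrableS.
- by apply: sub_integrableS FD; exact: sub_integrable_cst.
- by move=> x [Cx /not_andP[//|/negP]]; rewrite -leNgt.
Qed.

(* A Hahn decomposition, over F, of the charge P(A & .) - a P(B & .). *)
Lemma weak_hahn A B (a : R) : measurable A -> measurable B ->
  exists E, [/\ F E,
    forall C, F C -> C `<=` E -> p (A `&` C) <= a * p (B `&` C) &
    forall C, F C -> C `&` E = set0 -> a * p (B `&` C) <= p (A `&` C)].
Proof.
move=> mA mB; have [iA iB] := (ce_sub_integrable mA, ce_sub_integrable mB).
have iaB := sub_integrableZ a iB.
have intE C : F C -> a * p (B `&` C) = \int[P]_(x in C) (a * ce B x).
  move=> FC; rewrite RintegralZl ?Rintegral_ce//.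
    exact: (subset_measurable sF).
  exact: sub_integrableS.
exists [set x | ce A x <= a * ce B x]; split.
- exact: sub_integrable_le.
- move=> C FC CE; rewrite intE// -Rintegral_ce//.
  apply: le_Rintegral; [exact: (subset_measurable sF)| | |];
    try exact: sub_integrableS.
  by move=> x /CE.
- move=> C FC CE; rewrite intE// -Rintegral_ce//.
  apply: le_Rintegral; [exact: (subset_measurable sF)| | |];
    try exact: sub_integrableS.
  move=> x Cx; rewrite leNgt; apply/negP => h.
  suff : (C `&` [set x | ce A x <= a * ce B x]) x by rewrite CE.
  by split => //=; exact: ltW.
Qed.

End indicators.
End conditional_expectation.

Lemma exists_half_expn_lt (R : realType) (e : R) : 0 < e ->
  exists n, 2^-1 ^+ n < e.
Proof.
move=> e0; have [n _ /(_ n (leqnn n))] := near_infty_natSinv_expn_lt (PosNum e0).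
by rewrite /= div1r -exprVn => h; exists n.
Qed.

(** * Sets of maximal probability, by exhaustion *)

Section maximal_set.
Context (d : measure_display) (T : measurableType d) (R : realType).
Variables (P : probability T R) (K : set (set T)).
Hypothesis Km : K `<=` measurable.
Local Notation p A := (fine (P A)).

(** The premise [K nA.2] sits under the existential so that [choice] yields a total function. *)
Let almost_maximal_superset (nA : nat * set T) : exists B, K nA.2 ->
  [/\ K B, nA.2 `<=` B &
    forall C, K C -> B `<=` C -> p C <= p B + 2^-1 ^+ nA.1].
Proof.
case: nA => n A /=; have [KA|] := pselect (K A); last by exists A.
pose E := [set p B | B in [set B | K B /\ A `<=` B]].
have supE : has_sup E.
  split; first by exists (p A); exists A => //; split.
  exists 1 => _ [B [KB _] <-]; rewrite -(@fine_probT _ T R P).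
  by apply: fine_prob_le; [exact: Km|exact: measurableT|exact: subsetT].
have e0 : (0 : R) < 2^-1 ^+ n by rewrite exprn_gt0// invr_gt0.
have [_ [B [KB AB] <-] Bsup] := sup_adherent e0 supE.
exists B => _; split => // C KC BC; rewrite -lerBlDr.
apply: le_trans (ltW Bsup); rewrite lerD2r.
apply: sup_upper_bound => //; exists C => //; split => //.
exact: subset_trans BC.
Qed.

(** Greedy exhaustion: [B n.+1] is within 2^-n of the best superset of [B n], so a member of [K]
    containing the union exceeds it by at most 2^-n, for every n. *)
Lemma exists_maximal_set : K !=set0 ->
  (forall B : nat -> set T, nondecreasing_seq B -> (forall n, K (B n)) ->
    K (\bigcup_n B n)) ->
  exists M, K M /\ forall C, K C -> M `<=` C -> p C <= p M.
Proof.
move=> [A KA] Kcup; have [f fP] := choice almost_maximal_superset.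
pose B := fix B n := if n is m.+1 then f (m, B m) else A.
have KB n : K (B n) by elim: n => //= n /(fP (n, _))[].
have fB n := fP (n, B n) (KB n).
have ndB : nondecreasing_seq B.
  by apply/nondecreasing_seqP => n; apply/subsetPset; have [] := fB n.
have KU := Kcup _ ndB KB.
exists (\bigcup_n B n); split => // C KC UC.
apply/ler_addgt0Pr => e /exists_half_expn_lt[n ne].
have BU : B n.+1 `<=` \bigcup_n B n by move=> x ?; exists n.+1.
have [_ _ /(_ C KC (subset_trans BU UC))] := fB n.
move/le_trans; apply; apply: lerD (ltW ne).
by apply: fine_prob_le BU; [exact: Km (KB n.+1)|exact: Km KU].
Qed.

End maximal_set.

(** * Conditional halving *)

Section halving.
Context (d : measure_display) (T : measurableType d) (R : realType).
Variables (P : probability T R) (F G : set (set T)).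
Hypotheses (sF : is_sub_sigma_algebra F) (sG : is_sub_sigma_algebra G).
Hypothesis FG : F `<=` G.
Local Notation p A := (fine (P A)).

Let mF (C : set T) : F C -> measurable C. Proof. exact: subset_measurable. Qed.
Let mG (C : set T) : G C -> measurable C. Proof. exact: subset_measurable. Qed.

Let p_split (A C E : set T) : measurable A -> measurable C -> measurable E ->
  p (A `&` C) = p (A `&` (C `&` E)) + p (A `&` (C `\` E)).
Proof.
move=> mA mC mE; rewrite (@fine_probDI _ _ _ P _ E)//; last exact: measurableI.
by rewrite addrC setIA setIDA.
Qed.

Let p_sub (A B C : set T) : measurable A -> measurable B -> measurable C ->
  B `<=` A -> p (A `&` C) = p (B `&` C) + p ((A `\` B) `&` C).
Proof.
move=> mA mB mC BA; rewrite (@fine_probDI _ _ _ P _ B)//; last exact: measurableI.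
rewrite addrC; congr (p _ + p _).
  by rewrite setIAC (setIidr BA).
by rewrite !setDE setIAC.
Qed.

(** Conditional atomlessness at [A], tested on sets of [F] instead of through conditional
    expectations. For trivial [F] it only asks that 0 < P(B) < P(A) when P(A) > 0. *)
Definition conditionally_splits (A B : set T) := B `<=` A /\
  forall C, F C -> 0 < p (A `&` C) -> 0 < p (B `&` C) < p (A `&` C).

Hypothesis splittable : forall A, G A ->
  exists B, G B /\ conditionally_splits A B.

(** Keep [B] on the [F]-set [E] where it takes at most half of [A], and keep [A \ B] off [E], where
    [B] takes at least half. *)
Let small_half (A : set T) : G A -> exists B, [/\ G B, B `<=` A &
  forall C, F C -> p (B `&` C) <= 2^-1 * p (A `&` C) /\
    (0 < p (A `&` C) -> 0 < p (B `&` C))].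
Proof.
move=> GA; have [B [GB [BA Bsplit]]] := splittable GA.
have [mA mB] := (mG GA, mG GB).
have [E [FE Ele Ege]] := weak_hahn P sF (2^-1) mB mA.
have mE := mF FE.
pose B' := (B `&` E) `|` ((A `\` B) `\` E).
have GB' : G B'.
  apply: (sub_sigma_algebraU sG);
    first by apply: (sub_sigma_algebraI sG) => //; exact: FG.
  by do 2?apply: (sub_sigma_algebraD sG) => //; exact: FG.
have mB' := mG GB'.
exists B'; split => //.
  by move=> x [[/BA//]|[[]]].
move=> C FC; have mC := mF FC.
have FCE : F (C `&` E) by exact: (sub_sigma_algebraI sF).
have FCDE : F (C `\` E) by exact: (sub_sigma_algebraD sF).
have [mCE mCDE] := (mF FCE, mF FCDE).
rewrite (p_split mA mC mE) (p_split mB' mC mE).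
have -> : B' `&` (C `&` E) = B `&` (C `&` E).
  by apply/seteqP; split => x; rewrite /B' /=; tauto.
have -> : B' `&` (C `\` E) = (A `\` B) `&` (C `\` E).
  by apply/seteqP; split => x; rewrite /B' /=; tauto.
have := Ele _ FCE (@subIsetr _ _ _).
have := Ege _ FCDE (@setDKI _ _ _).
have := p_sub mA mB mCDE BA.
have := Bsplit _ FCE.
have := Bsplit _ FCDE.
have := fine_prob_ge0 P (A `&` (C `&` E)).
have := fine_prob_ge0 P (A `&` (C `\` E)).
have := fine_prob_ge0 P (B `&` (C `&` E)).
have := fine_prob_ge0 P ((A `\` B) `&` (C `\` E)).
set a := p _; set b := p _; set a1 := p _; set a2 := p _; set b2 := p _.
move=> ? ? ? ? h1 h2 ? ? ?; split; first by lra.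
(* [a2] and [a1] are the probabilities of [A] over [C & E] and [C \ E]; one of them is positive, and
   [B] splits [A] there. *)
move=> ?; have [a20|a20] := ltP 0 a2.
  have := h2 a20; lra.
have : 0 < a1 by lra.
move/h1; lra.
Qed.

Let small_subset (n : nat) (A : set T) : G A -> exists B, [/\ G B, B `<=` A &
  forall C, F C -> p (B `&` C) <= 2^-1 ^+ n * p (A `&` C) /\
    (0 < p (A `&` C) -> 0 < p (B `&` C))].
Proof.
elim: n A => [|n IH] A GA.
  by exists A; split => // C FC; rewrite expr0 mul1r.
have [B [GB BA BP]] := IH A GA; have [D [GD DB DP]] := small_half GB.
exists D; split => //; first exact: subset_trans BA.
move=> C FC; have [B1 B2] := BP C FC; have [D1 D2] := DP C FC.
split; last by move/B2/D2.
rewrite exprS -mulrA; apply: le_trans D1 _.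
by rewrite ler_pM2l// invr_gt0.
Qed.

Lemma exists_conditional_half (A : set T) : G A ->
  exists B, [/\ G B, B `<=` A &
    forall C, F C -> p (B `&` C) = 2^-1 * p (A `&` C)].
Proof.
move=> GA; have mA := mG GA.
pose K := [set B | [/\ G B, B `<=` A &
  forall C, F C -> p (B `&` C) <= 2^-1 * p (A `&` C)]].
have Km : K `<=` measurable by move=> B [/mG].
have K0 : K set0.
  split; [|by []|].
    by rewrite -(sub_sigma_algebra_measurableE sG); exact: measurable0.
  by move=> C FC; rewrite set0I measure0 mulr_ge0// fine_prob_ge0.
have Kcup (B : nat -> set T) : nondecreasing_seq B -> (forall n, K (B n)) ->
    K (\bigcup_n B n).
  move=> ndB KB; split.
  - by have [_ _] := sG.1; apply => n; have [] := KB n.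
  - by apply: bigcup_sub => n _; have [] := KB n.
  - move=> C FC; have mC := mF FC.
    have mBC n : measurable (B n `&` C) by apply: measurableI => //; exact: Km.
    have mU : measurable (\bigcup_n (B n `&` C)) by exact: bigcupT_measurable.
    have ndBC : nondecreasing_seq (fun n => B n `&` C).
      move=> m n /ndB/subsetPset mn; apply/subsetPset => x [? ?].
      by split => //; exact: mn.
    rewrite setI_bigcupl -lee_fin fine_probK//.
    apply: cvge_to_le (nondecreasing_cvg_mu mBC mU ndBC) _.
    near=> n; have [_ _ /(_ C FC)] := KB n.
    by rewrite -lee_fin fine_probK.
have [M [[GM MA Mle] Mmax]] := exists_maximal_set P Km (ex_intro _ _ K0) Kcup.
have mM := mG GM.
exists M; split => // C FC; have mC := mF FC.
apply/eqP; rewrite eq_le Mle//= leNgt; apply/negP => Mlt.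
(* 2^-n is taken below the deficit of [M] over [C], so that [B], of conditional probability at most
   2^-n, is too thin to fill the gap. *)
have [n nlt] := exists_half_expn_lt (etrans (subr_gt0 _ _) Mlt).
have [B [GB BAM BP]] := small_subset n (sub_sigma_algebraD sG GA GM).
have mB := mG GB.
have BM C' : F C' -> p ((M `|` B) `&` C') = p (M `&` C') + p (B `&` C').
  move=> /mF mC'; rewrite setIUl fine_probU//; try exact: measurableI.
  rewrite -subset0 => x [[Mx _] [Bx _]].
  by have [] := BAM _ Bx.
(* [E] is where [M], even with all of [B] added, still takes at most half of [A]. *)
have [E [FE Ele Ege]] := weak_hahn P sF (2^-1) (measurableU _ _ mM mB) mA.
have mE := mF FE.
have mBE := measurableI _ _ mB mE.
have FCE : F (C `&` E) by exact: (sub_sigma_algebraI sF).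
have FCDE : F (C `\` E) by exact: (sub_sigma_algebraD sF).
have [mCE mCDE] := (mF FCE, mF FCDE).
have MBE : M `&` (B `&` E) = set0.
  by rewrite -subset0 => x [Mx [Bx _]]; have [] := BAM _ Bx.
(* [B] may be added to [M] on [E]; maximality of [M] then forces [A] and [M] to
   coincide a.s. on [E], while off [E] the deficit of [M] is at most 2^-n. *)
have KMBE : K (M `|` (B `&` E)).
  split.
  - apply: (sub_sigma_algebraU sG) => //.
    by apply: (sub_sigma_algebraI sG) => //; exact: FG.
  - by move=> x [/MA//|[/BAM[]]].
  - move=> C' FC'; have mC' := mF FC'.
    have FC'E : F (C' `&` E) by exact: (sub_sigma_algebraI sF).
    have FC'DE : F (C' `\` E) by exact: (sub_sigma_algebraD sF).
    rewrite (p_split (measurableU _ _ mM mBE) mC' mE) (p_split mA mC' mE).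
    have -> : (M `|` (B `&` E)) `&` (C' `&` E) = (M `|` B) `&` (C' `&` E).
      by apply/seteqP; split => x /=; tauto.
    have -> : (M `|` (B `&` E)) `&` (C' `\` E) = M `&` (C' `\` E).
      by apply/seteqP; split => x /=; tauto.
    have := Ele _ FC'E (@subIsetr _ _ _); have := Mle _ FC'DE.
    lra.
have pBE0 : p (B `&` E) = 0.
  have := Mmax _ KMBE (@subsetUl _ _ _).
  rewrite fine_probU//; have := fine_prob_ge0 P (B `&` E); lra.
(* Were this positive, [B] would have positive probability on [E] too. *)
have pAME0 : p ((A `\` M) `&` E) = 0.
  have [_ h] := BP E FE; have := fine_prob_ge0 P ((A `\` M) `&` E).
  rewrite le_eqVlt => /predU1P[//|/h]; rewrite pBE0; lra.
have pAMCE0 : p ((A `\` M) `&` (C `&` E)) = 0.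
  apply/eqP; rewrite eq_le fine_prob_ge0 andbT -pAME0.
  apply: fine_prob_le; [| |by move=> x [? []]];
    by apply: measurableI => //; exact: measurableD.
have [BCDE _] := BP _ FCDE.
have AMle1 : p ((A `\` M) `&` (C `\` E)) <= 1.
  rewrite -(@fine_probT _ T R P);
  apply: fine_prob_le; [|exact: measurableT|exact: subsetT].
  by apply: measurableI => //; exact: measurableD.
have BCDEn : p (B `&` (C `\` E)) <= 2^-1 ^+ n.
  by apply: le_trans BCDE _; rewrite ger_pMr// exprn_gt0// invr_gt0.
have MA1 := p_sub mA mM mCE MA.
have Ege1 := Ege _ FCDE (@setDKI _ _ _).
rewrite BM// in Ege1.
move: nlt; rewrite (p_split mA mC mE) (p_split mM mC mE).
have := fine_prob_ge0 P (M `&` (C `&` E)).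
lra.
Unshelve. all: by end_near. Qed.

End halving.

(** * Dyadic trees of sets *)

Section dyadic_tree.
Context (T : Type).
Implicit Types (D : seq bool -> set T).

(* Sequences of bits are read from right to left: [b :: s] is a child of [s]. *)
Definition dyadic_tree D := D [::] = setT /\
  forall s, D s = D (true :: s) `|` D (false :: s) /\
            D (true :: s) `&` D (false :: s) = set0.

Variable D : seq bool -> set T.
Hypothesis tD : dyadic_tree D.

Lemma dyadic_tree_child (b : bool) (s : seq bool) : D (b :: s) `<=` D s.
Proof. by have [-> _] := tD.2 s; case: b => x; [left|right]. Qed.

Lemma dyadic_tree_descendant (t s : seq bool) : D (t ++ s) `<=` D s.
Proof.
by elim: t => // b t IH; apply: subset_trans IH; exact: dyadic_tree_child.
Qed.

Lemma dyadic_tree_disjoint (s t : seq bool) : size s = size t -> s <> t ->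
  D s `&` D t = set0.
Proof.
elim: s t => [|b s IH] [|c t]//= [st] bsct.
have [est|nst] := pselect (s = t); last first.
  rewrite -subset0 -(IH _ st nst).
  by move=> x [/dyadic_tree_child ? /dyadic_tree_child].
have [_ tf0] := tD.2 t; rewrite {}est in bsct *.
by case: b c bsct => [] [] // _; rewrite setIC.
Qed.

(** The longer word [t] has a suffix [u] of the length of [s]; [D t] lies in [D u], which is either
    [D s] or disjoint from it. This gives the pi-system needed for uniqueness of measures. *)
Lemma dyadic_tree_setI_closed : setI_closed ([set set0] `|` range D).
Proof.
have comparable s t : (size s <= size t)%N ->
    ([set set0] `|` range D) (D s `&` D t).
  move=> st; pose u := drop (size t - size s) t.
  have tu : D t `<=` D u.
    by rewrite -{1}(cat_take_drop (size t - size s) t); exact: dyadic_tree_descendant.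
  have [->|su] := pselect (s = u).
    by right; exists t => //; rewrite setIidr.
  left => /=; rewrite -subset0 -(@dyadic_tree_disjoint s u) //; first exact: setIS.
  by rewrite size_drop subKn.
move=> _ _ [->|[s _ <-]] [->|[t _ <-]]; rewrite ?set0I ?setI0; try by left.
have [/comparable//|/ltnW/comparable] := leqP (size s) (size t).
by rewrite setIC.
Qed.

End dyadic_tree.

(** * Trees independent of [F]: construction, and conditional atomlessness *)

Section independent_dyadic_tree.
Context (d : measure_display) (T : measurableType d) (R : realType).
Variables (P : probability T R) (F : set (set T)).
Hypothesis sF : is_sub_sigma_algebra F.
Local Notation p A := (fine (P A)).
Local Notation ce A := (cond_expectation P F \1_A).

Definition independent_dyadic_tree (D : seq bool -> set T) :=
  [/\ dyadic_tree D, forall s, measurable (D s) &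
    forall s C, F C -> p (D s `&` C) = 2^-1 ^+ size s * p C].

(** Iterated halving. The pair [F], [G] is general because it serves twice: [F1] within all
    measurable sets, and the trivial sigma-algebra within an independent atomless one. *)
Lemma exists_independent_dyadic_tree (G : set (set T)) :
  is_sub_sigma_algebra G -> F `<=` G ->
  (forall A, G A -> exists B, G B /\ conditionally_splits P F A B) ->
  exists D, (forall s, G (D s)) /\ independent_dyadic_tree D.
Proof.
move=> sG FG splittable.
have /choice[f fP] A : exists B, G A -> [/\ G B, B `<=` A &
    forall C, F C -> p (B `&` C) = 2^-1 * p (A `&` C)].
  have [/(exists_conditional_half sF sG FG splittable)[B BP]|] := pselect (G A).
    by exists B.
  by exists A.
pose D := fix D s := if s is b :: s' then
  if b then f (D s') else D s' `\` f (D s') else setT.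
have GD s : G (D s).
  elim: s => [|[] s /= Ds]; first exact: sub_sigma_algebraT.
    by have [] := fP _ Ds.
  by apply: (sub_sigma_algebraD sG) => //; have [] := fP _ Ds.
have mD s : measurable (D s) by exact: (subset_measurable sG).
exists D; split => //; split => //.
  split => // s; have [_ sub _] := fP _ (GD s); split => /=.
    by rewrite setDUK.
  by rewrite setIC setDKI.
elim=> [|b s IH] C FC; first by rewrite /= setTI expr0 mul1r.
have [_ sub half] := fP _ (GD s); rewrite exprS -mulrA -IH//.
have mC := subset_measurable sF FC.
have ht : p (D (true :: s) `&` C) = 2^-1 * p (D s `&` C) by exact: half.
(* For the second child, adding the share of the first reduces the claim to additivity over
   [D s]. *)
case: b => //; apply: (@addrI _ (p (D (true :: s) `&` C))).
rewrite -fine_probU; [|exact: measurableI|exact: measurableI|].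
  rewrite -setIUl /= setDUK// -/(D (true :: s)) ht; lra.
by rewrite setIACA /= [f _ `&` _]setIC setDKI set0I.
Qed.

Lemma ae_forall_countable (I : countType) (Q : I -> T -> Prop) :
  (forall i, {ae P, forall x, Q i x}) -> {ae P, forall x, forall i, Q i x}.
Proof.
move=> aeQ.
have : {ae P, forall x, forall n, if unpickle n is Some i then Q i x else True}.
  apply: ae_foralln => n; case: (unpickle n) => [i|]; first exact: aeQ.
  exact: aeW.
by apply: filterS => x Qx i; have := Qx (pickle i); rewrite pickleK.
Qed.

Lemma independent_dyadic_tree_conditionally_atomless (D : seq bool -> set T) :
  independent_dyadic_tree D -> conditionally_atomless P F.
Proof.
move=> [tD mD pD] A mA.
have mAD s : measurable (A `&` D s) by exact: measurableI.
have iA := ce_sub_integrable P sF mA.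
have iAD s := ce_sub_integrable P sF (mAD s).
(* An enumeration of the words. The default [[::]] is harmless: [D [::]] is the whole space, so the
   corresponding [E n] is empty. *)
pose e n : seq bool := odflt [::] (unpickle n).
pose E n := [set x | 0 < ce (A `&` D (e n)) x < ce A x].
have FE n : F (E n).
  rewrite (_ : E n = [set x | 0 < ce (A `&` D (e n)) x] `&`
                     [set x | ce (A `&` D (e n)) x < ce A x]).
    apply: (sub_sigma_algebraI sF).
      exact: (sub_integrable_lt sF (sub_integrable_cst P F 0)).
    exact: (sub_integrable_lt sF).
  by apply/seteqP; split => x /=; [move=> /andP[]|move=> [? ?]; apply/andP].
(* [S n] is where [e n] is the first word that splits [A]. *)
pose S := seqDU E.
have FS n : F (S n).
  rewrite -(sub_sigma_algebra_measurableE sF).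
  by apply: seqDU_measurable => m; rewrite sub_sigma_algebra_measurableE.
have mS n := subset_measurable sF (FS n).
have ceSAD : {ae P, forall x, forall s,
    ce (A `&` D s) x <= 2^-1 ^+ size s}.
  apply: ae_forall_countable => s; apply: (ae_ce_le_cst sF) => // C FC.
  have mC := subset_measurable sF FC.
  rewrite -pD//; apply: fine_prob_le; try exact: measurableI.
  by move=> x [[]].
have ge0 : {ae P, forall x, forall s, 0 <= ce (A `&` D s) x}.
  by apply: ae_forall_countable => s; exact: (ae_ce_ge0 P sF).
have add : {ae P, forall x, forall s, ce (A `&` D s) x =
    ce (A `&` D (true :: s)) x + ce (A `&` D (false :: s)) x}.
  apply: ae_forall_countable => s; have [DsE Ds0] := tD.2 s.
  rewrite DsE setIUr; apply: (ae_ceU P sF) => //.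
  by rewrite setIACA Ds0 setI0.
pose B := \bigcup_n (A `&` D (e n) `&` S n).
have mB : measurable B by apply: bigcupT_measurable => n; exact: measurableI.
have BS n : B `&` S n `<=` A `&` D (e n).
  move=> x [[m _ [ADx Smx]] Snx]; suff <- : m = n by [].
  by apply: (trivIset_seqDU E) => //; exists x.
have ceB : {ae P, forall x, forall n, S n x -> ce B x = ce (A `&` D (e n)) x}.
  apply: ae_foralln => n.
  have le1 := ae_ce_le P sF mB (mAD (e n)) (FS n) (@BS n).
  have : A `&` D (e n) `&` S n `<=` B by move=> x ?; exists n.
  move/(ae_ce_le P sF (mAD (e n)) mB (FS n)).
  apply: filterS2 le1 => x h1 h2 Sx; apply/eqP.
  by rewrite eq_le h1// h2.
exists B; split => //; first by move=> x [n _ [[]]].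
apply: filterS3 (filterI ceSAD ge0) add ceB => x [{}ceSAD {}ge0] {}add {}ceB Ax.
have [[s sE]|nE] := pselect (exists s, 0 < ce (A `&` D s) x < ce A x).
  have : (\bigcup_n E n) x.
    by exists (pickle s); rewrite // /E /mkset /e pickleK.
  by rewrite seqDU_bigcup_eq => -[n _ Sx]; rewrite (ceB n)//; case: Sx.
have [n nlt] := exists_half_expn_lt Ax.
(* With no splitting word at [x], a node carrying all of [ce A x] passes it whole to one child,
   since the two children's values are nonnegative and add up to it. *)
have [s [sn sA]] : exists s, size s = n /\ ce (A `&` D s) x = ce A x.
  elim: n {nlt} => [|n [s [sn sA]]]; first by exists [::]; rewrite tD.1 setIT.
  have := add s; rewrite sA => sE.
  have [t0|t0] := ltP 0 (ce (A `&` D (true :: s)) x).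
    exists (true :: s); split => /=; first by rewrite sn.
    apply/eqP; rewrite eq_le; apply/andP; split.
      by have := ge0 (false :: s); lra.
    by rewrite leNgt; apply/negP => tA; apply: nE; exists (true :: s); rewrite t0.
  exists (false :: s); split => /=; first by rewrite sn.
  by have := ge0 (true :: s); lra.
by have := ceSAD s; rewrite sn sA => /(lt_le_trans nlt); rewrite ltxx.
Qed.

End independent_dyadic_tree.

(** * From conditional atomlessness to an independent atomless sigma-algebra *)

Section atomless.
Context (d : measure_display) (T : measurableType d) (R : realType).
Variables (P : probability T R) (F : set (set T)).
Hypothesis sF : is_sub_sigma_algebra F.
Local Notation p A := (fine (P A)).
Local Notation ce A := (cond_expectation P F \1_A).

(** Both [B] and [A \ B] have a.s. positive conditional probability wherever [A] does, so
    [measure_gt0_of_ce] applies to each. *)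
Lemma conditionally_atomless_splits (A : set T) :
  conditionally_atomless P F -> measurable A ->
  exists B, measurable B /\ conditionally_splits P F A B.
Proof.
move=> atomlessP mA; have [B [mB BA aeB]] := atomlessP A mA.
exists B; split => //; split => // C FC A0.
have mC := subset_measurable sF FC.
have mAB := measurableD mA mB.
have aeAB : {ae P, forall x, ce A x = ce B x + ce (A `\` B) x}.
  by have := ae_ceU P sF mB mAB; rewrite setDUK//; apply; rewrite setDIK.
have B0 : 0 < p (B `&` C).
  apply: (measure_gt0_of_ce sF mA mB FC _ A0).
  by apply: filterS aeB => x /[apply] /andP[].
have AB0 : 0 < p ((A `\` B) `&` C).
  apply: (measure_gt0_of_ce sF mA mAB FC _ A0).
  apply: filterS2 aeB aeAB => x + ABx => /[apply] /andP[_].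
  by rewrite ABx ltrDl.
rewrite B0/= -(setDUK BA) setIUl fine_probU; try exact: measurableI.
  by rewrite ltrDl.
by rewrite setIACA setDIK set0I.
Qed.

Section generated.
Variable D : seq bool -> set T.
Hypothesis DP : independent_dyadic_tree P F D.
Let G := <<s [set set0] `|` range D >>.

Let generators_measurable : [set set0] `|` range D `<=` measurable.
Proof. by have [_ mD _] := DP; move=> _ [->|[s _ <-]]. Qed.

Lemma dyadic_tree_sub_sigma_algebra : is_sub_sigma_algebra G.
Proof.
split; first exact: smallest_sigma_algebra.
apply: smallest_sub; first exact: sigma_algebra_measurable.
exact: generators_measurable.
Qed.

Let GD s : G (D s).
Proof. by apply: sub_sigma_algebra; right; exists s. Qed.

(** Choose n with 2^-n < P(A): some node of level n meets [A] with positive probability, and that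
    probability is at most 2^-n. *)
Lemma dyadic_tree_atomless : atomless_on P G.
Proof.
move=> A GA; have mA := subset_measurable dyadic_tree_sub_sigma_algebra GA.
have [tD mD pD] := DP.
rewrite -fine_prob_gt0// => A0; have [n nlt] := exists_half_expn_lt A0.
have [s [sn As0]] : exists s, size s = n /\ 0 < p (A `&` D s).
  elim: n {nlt} => [|n [s [sn As0]]]; first by exists [::]; rewrite tD.1 setIT.
  have [t0|t0] := ltP 0 (p (A `&` D (true :: s))).
    by exists (true :: s); rewrite /= sn.
  exists (false :: s); split; first by rewrite /= sn.
  have [DsE Ds0] := tD.2 s; move: As0.
  rewrite DsE setIUr fine_probU; [|exact: measurableI|exact: measurableI|].
    lra.
  by rewrite setIACA Ds0 setI0.
have mADs := measurableI _ _ mA (mD s).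
exists (A `&` D s); split;
  first exact: (sub_sigma_algebraI dyadic_tree_sub_sigma_algebra).
  exact: subIsetl.
rewrite -fine_prob_gt0// As0 -(fine_probK P mADs) -(fine_probK P mA) lte_fin.
apply: le_lt_trans nlt; rewrite -sn.
have := pD s setT (sub_sigma_algebraT sF).
rewrite setIT fine_probT mulr1 => <-.
by apply: fine_prob_le => //; exact: subIsetr.
Qed.

(** For fixed [C], the finite measures P(. & C) and P(C) P(.) agree on the pi-system of nodes, hence
    on the sigma-algebra it generates. *)
Lemma dyadic_tree_independent : independent_set_systems P G F.
Proof.
move=> A C GA FC; have [tD mD pD] := DP; have mC := subset_measurable sF FC.
have pDE s : P (D s `&` C) = (P C * P (D s))%E.
  have mDC := measurableI _ _ (mD s) mC.
  rewrite -(fine_probK P mDC) -(fine_probK P mC) -(fine_probK P (mD s)).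
  rewrite -EFinM; congr EFin.
  rewrite pD// mulrC; congr *%R.
  have := pD s setT (sub_sigma_algebraT sF).
  by rewrite setIT fine_probT mulr1.
pose m1 : {measure set T -> \bar R} := mrestr P mC.
pose m2 : {measure set T -> \bar R} := mscale (NngNum (fine_prob_ge0 P C)) P.
have m2E B : m2 B = (P C * P B)%E by rewrite /m2 /= /mscale /= fine_probK.
rewrite muleC -m2E -[LHS]/(m1 A).
apply: (g_sigma_algebra_measure_unique ([set set0] `|` range D) _ (fun=> D [::])) => //.
- by move=> _; right; exists [::].
- by rewrite tD.1 bigcup_const//; exists 0%N.
- exact: dyadic_tree_setI_closed.
- move=> _ [->|[s _ <-]]; first by rewrite !measure0.
  by rewrite m2E -pDE.
- move=> _; apply: le_lt_trans (ltry 1); rewrite /m1 /= /mrestr /=.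
  by apply: probability_le1; exact: measurableI.
Qed.

End generated.
End atomless.

(** * The trivial sigma-algebra and the equivalence *)

Lemma trivial_sub_sigma_algebra (d : measure_display) (T : measurableType d) :
  is_sub_sigma_algebra [set set0; setT : set T].
Proof.
split; last by move=> _ [] -> //; exact: measurableT.
split; first by left.
- by move=> _ [] ->; [right; rewrite setD0|left; rewrite setDT].
- move=> A AP; have [[n An]|nA] := pselect (exists n, A n = setT).
    by right; apply/seteqP; split => // x _; exists n => //; rewrite An.
  left => /=; rewrite -subset0 => x [n _]; have [->//|An] := AP n.
  by exfalso; apply: nA; exists n.
Qed.

Theorem theorem2 (R : realType) (d : measure_display) (T : measurableType d)
    (P : probability T R) (F1 : set (set T)) :
  is_sub_sigma_algebra F1 ->
  (conditionally_atomless P F1 <->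
   exists B : set (set T),
     [/\ is_sub_sigma_algebra B,
         atomless_on P B &
         independent_set_systems P B F1]).
Proof.
move=> sF1; split.
  move=> atomlessP.
  have sm : is_sub_sigma_algebra (@measurable d T).
    by split => //; exact: sigma_algebra_measurable.
  have [D [_ DP]] := exists_independent_dyadic_tree sF1 sm sF1.2
    (fun A => conditionally_atomless_splits sF1 atomlessP).
  exists <<s [set set0] `|` range D >>; split.
  - exact: dyadic_tree_sub_sigma_algebra DP.
  - exact: dyadic_tree_atomless DP.
  - exact: dyadic_tree_independent DP.
move=> [B [sB atomlessB indep]].
have trivB : [set set0; setT] `<=` B.
  by move=> _ [] ->; [have [] := sB.1|exact: sub_sigma_algebraT].
(* Over the trivial sigma-algebra, splitting is ordinary atomlessness, so [B] contains a tree with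
   P(D s) = 2^-|s|. *)
have [A BA|D [BD [tD mD pD]]] := @exists_independent_dyadic_tree _ T R P _
  (@trivial_sub_sigma_algebra d T) B sB trivB.
  have mA := subset_measurable sB BA.
  have [A0|A0] := ltP 0%E (P A).
    have [C [BC CA /andP[C0 CltA]]] := atomlessB A BA A0.
    have mC := subset_measurable sB BC.
    exists C; split => //; split => // _ [] ->; rewrite ?setI0 ?measure0 ?ltxx//.
    by rewrite !setIT => _; rewrite fine_prob_gt0// C0 -lte_fin !fine_probK.
  (* A null [A] satisfies the splitting condition vacuously. *)
  exists A; split => //; split => // _ [] ->; rewrite ?setI0 ?measure0 ?ltxx//.
  by rewrite setIT fine_prob_gt0// ltNge A0.
apply: (@independent_dyadic_tree_conditionally_atomless _ T R P F1 sF1 D).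
(* Independence of [B] from [F1] upgrades P(D s) = 2^-|s| to every [C] in [F1]. *)
split => // s C FC; rewrite (indep _ _ (BD s) FC) fineM ?fin_num_measure//.
  congr (_ * _); have := pD s setT; rewrite setIT => ->; last by right.
  by rewrite fine_probT mulr1.
exact: (subset_measurable sF1).
Qed.
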